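(* Let $f:\mathbb{R}^{m\times n}\to\mathbb{R}$ be twice differentiable and let $g(A,B)=f(AB^\top)$ for $(A,B)\in\mathbb{R}^{m\times r}\times\mathbb{R}^{n\times r}$. Assume that $f$ satisfies $\alpha$-RSC and $\beta$-RSM, with $\alpha>0$, over an open subset $\mathcal{X}\subseteq\mathbb{R}^{m\times n}_{\mathrm{rank}(r)}$. Let $\kappa=\beta/\alpha$. Then: (1) For any fixed point $X\in\mathcal{X}$ of projected gradient descent (PGD) with step size $\eta=1/\beta$, $$f(X)\le\min_{\mathrm{rank}(Y)<r/\kappa^2,\ Y\in\mathcal{X}}f(Y),$$ i.e. $X$ satisfies restricted optimality with respect to any rank $r'<r/\kappa^2$ within $\mathcal{X}$. (2) For any $X=AB^\top\in\mathcal{X}$ where $(A,B)$ is a second-order stationary point (SOSP) of the factorized problem $g(A,B)$, $$f(AB^\top)\le\min_{\mathrm{rank}(Y)<r/\kappa^2,\ Y\in\mathcal{X}}f(Y),$$ i.e. $X=AB^\top$ satisfies restricted optimality with respect to any rank $r'<r/\kappa^2$ within $\mathcal{X}$.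
   Context: Here $m,n,r$ are positive integers. $\|\cdot\|_F$ is the Frobenius norm and $\langle\cdot,\cdot\rangle$ the trace inner product. $\mathbb{R}^{m\times n}_{\mathrm{rank}(r)}$ denotes the set of $m\times n$ matrices of rank $\le r$; ''open subset'' means open relative to this set. $f$ satisfies $\alpha$-RSC (restricted strong convexity) over $\mathcal{X}$ if $f(Y)\ge f(X)+\langle\nabla f(X),Y-X\rangle+\frac\alpha2\|X-Y\|_F^2$ for all $X,Y\in\mathcal{X}$, and $\beta$-RSM (restricted smoothness) over $\mathcal{X}$ if $f(Y)\le f(X)+\langle\nabla f(X),Y-X\rangle+\frac\beta2\|X-Y\|_F^2$ for all $X,Y\in\mathcal{X}$. PGD for $\min_{\mathrm{rank}(X)\le r}f(X)$ with step size $\eta>0$ has updates $X\leftarrow\mathcal{P}_r(X-\eta\nabla f(X))$, where $\mathcal{P}_r$ is (possibly non-unique) Frobenius-norm projection onto the matrices of rank $\le r$. A matrix $X$ of rank $\le r$ is a fixed point of PGD at step size $\eta$ if $X\in\arg\min_{\mathrm{rank}(X')\le r}\|X'-(X-\eta\nabla f(X))\|_F^2$. $(A,B)$ is a SOSP of $g$ if $\nabla g(A,B)=0$ and $\nabla^2g(A,B)\succeq0$. A matrix $X$ satisfies restricted optimality with respect to rank $r'$ within $\mathcal{X}$ if $f(X)\le f(Y)$ for every $Y\in\mathcal{X}$ with $\mathrm{rank}(Y)\le r'$. *)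

(* Defs.v *)
From HB Require Import structures.
From mathcomp Require Export all_boot all_order all_algebra.
From mathcomp Require Export all_classical all_reals all_analysis.
Export Order.TTheory GRing.Theory Num.Theory numFieldNormedType.Exports.

Set Implicit Arguments.
Unset Strict Implicit.
Unset Printing Implicit Defensive.

Local Open Scope classical_set_scope.
Local Open Scope ring_scope.

Definition frob_inner (R : realType) (m n : nat) (X Y : 'M[R]_(m, n)) : R :=
  \tr (X^T *m Y).

Definition frob_norm (R : realType) (m n : nat) (X : 'M[R]_(m, n)) : R :=
  Num.sqrt (frob_inner X X).

(* The gradient for the trace inner product: its (i, j) entry is the partial
   derivative in the (i, j) coordinate. *)
Definition gradient (R : realType) (m n : nat) (f : 'M[R]_(m, n) -> R)
    (X : 'M[R]_(m, n)) : 'M[R]_(m, n) :=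
  \matrix_(i, j) 'D_(delta_mx i j) f X.

(* The normed-module structure of the library on matrices uses the max norm;
   in finite dimension this gives the same notions of openness and
   differentiability as the Frobenius norm. *)
Definition twice_differentiable (R : realType) (m n : nat)
    (f : 'M[R]_(m, n) -> R) : Prop :=
  forall X, differentiable f X /\ differentiable (gradient f) X.

Definition rank_le (R : realType) (m n r : nat) : set 'M[R]_(m, n) :=
  [set X | (\rank X <= r)%N].

Definition relatively_open (R : realType) (m n : nat)
    (D calX : set 'M[R]_(m, n)) : Prop :=
  exists2 U : set 'M[R]_(m, n), open U & calX = U `&` D.

Definition RSC (R : realType) (m n : nat) (alpha : R) (f : 'M[R]_(m, n) -> R)
    (calX : set 'M[R]_(m, n)) : Prop :=
  forall X Y, calX X -> calX Y ->
    f Y >= f X + frob_inner (gradient f X) (Y - X)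
           + alpha / 2 * frob_norm (X - Y) ^+ 2.

Definition RSM (R : realType) (m n : nat) (beta : R) (f : 'M[R]_(m, n) -> R)
    (calX : set 'M[R]_(m, n)) : Prop :=
  forall X Y, calX X -> calX Y ->
    f Y <= f X + frob_inner (gradient f X) (Y - X)
           + beta / 2 * frob_norm (X - Y) ^+ 2.

(* Set-valued, since the nearest matrix of rank at most r need not be unique. *)
Definition rank_proj (R : realType) (m n r : nat) (Z : 'M[R]_(m, n)) :
    set 'M[R]_(m, n) :=
  [set X : 'M[R]_(m, n) | rank_le r X /\
    forall X' : 'M[R]_(m, n), rank_le r X' ->
      frob_norm (X - Z) ^+ 2 <= frob_norm (X' - Z) ^+ 2].

Definition pgd_fixed_point (R : realType) (m n r : nat)
    (f : 'M[R]_(m, n) -> R) (eta : R) (X : 'M[R]_(m, n)) : Prop :=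
  rank_proj r (X - eta *: gradient f X) X.

Definition factorized (R : realType) (m n r : nat) (f : 'M[R]_(m, n) -> R)
    (z : 'M[R]_(m, r) * 'M[R]_(n, r)) : R :=
  f (z.1 *m z.2^T).

Definition gradient_pair (R : realType) (m n r : nat)
    (g : 'M[R]_(m, r) * 'M[R]_(n, r) -> R) (z : 'M[R]_(m, r) * 'M[R]_(n, r)) :
    'M[R]_(m, r) * 'M[R]_(n, r) :=
  (gradient (fun A => g (A, z.2)) z.1, gradient (fun B => g (z.1, B)) z.2).

(* The Hessian as a bilinear form; the iterated directional derivatives exist
   and are bilinear in (v, w) when g is twice differentiable at z. *)
Definition hessian (R : realType) (V : normedModType R) (g : V -> R)
    (z v w : V) : R :=
  'D_v (fun y => 'D_w g y) z.

Definition SOSP (R : realType) (m n r : nat)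
    (g : 'M[R]_(m, r) * 'M[R]_(n, r) -> R)
    (z : 'M[R]_(m, r) * 'M[R]_(n, r)) : Prop :=
  gradient_pair g z = 0 /\ forall w, 0 <= hessian g z w w.

Definition restricted_optimal (R : realType) (m n : nat)
    (f : 'M[R]_(m, n) -> R) (calX : set 'M[R]_(m, n)) (r' : nat)
    (X : 'M[R]_(m, n)) : Prop :=
  forall Y, calX Y -> (\rank Y <= r')%N -> f X <= f Y.

(* Main.v *)
Require Import Defs.
From mathcomp Require Import all_boot all_order all_algebra.
From mathcomp Require Import all_classical all_reals all_analysis.
From mathcomp Require Import ring lra.

Set Implicit Arguments.
Unset Strict Implicit.
Unset Printing Implicit Defensive.

Local Open Scope classical_set_scope.
Local Open Scope ring_scope.

(* Let G be the gradient of f at X. Both kinds of stationarity make G vanish on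
   the row and column spaces of X and, if X has rank r, bound every singular
   value of G by beta times the least nonzero singular value of X; if X has
   lower rank, then G = 0. By restricted strong convexity it suffices that
   <G, Y - X> + alpha/2 |X - Y|^2 >= 0, that is, that X - G / alpha is no closer
   to Y than to X. With Q the projection onto the row space of Y this
   reduces to |G Q|^2 <= alpha^2 |X (1 - Q)|^2, where Q has rank at most r' and
   1 - Q meets the row space of X in dimension at least r - r'. The singular
   values are never introduced: their comparison is the inequality
   |p|^2 |G w|^2 <= beta^2 |X p|^2 |w|^2 for p in the row space of X. For a PGD
   fixed point it follows by testing against rank-one modifications of X; for a
   second-order stationary point, from the curvature along
   t |-> (A + t U)(B + t W)^T, which smoothness bounds from above. *)

(** * Algebra of the trace inner product *)

Section FrobeniusInner.
Variable R : realType.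

Section Bilinear.
Variables m n : nat.
Implicit Types X Y Z : 'M[R]_(m, n).

Lemma frob_innerE X Y :
  frob_inner X Y = \sum_(j < n) \sum_(i < m) X i j * Y i j.
Proof.
by apply: eq_bigr => j _; rewrite !mxE; apply: eq_bigr => i _; rewrite !mxE.
Qed.

Lemma frob_innerC X Y : frob_inner X Y = frob_inner Y X.
Proof. by rewrite /frob_inner -mxtrace_tr trmx_mul trmxK. Qed.

Lemma frob_innerDr X Y Z :
  frob_inner X (Y + Z) = frob_inner X Y + frob_inner X Z.
Proof. by rewrite /frob_inner mulmxDr mxtraceD. Qed.

Lemma frob_innerZr (a : R) X Y : frob_inner X (a *: Y) = a * frob_inner X Y.
Proof. by rewrite /frob_inner -scalemxAr mxtraceZ. Qed.

Lemma frob_innerNr X Y : frob_inner X (- Y) = - frob_inner X Y.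
Proof. by rewrite -scaleN1r frob_innerZr mulN1r. Qed.

Lemma frob_innerDl X Y Z :
  frob_inner (Y + Z) X = frob_inner Y X + frob_inner Z X.
Proof. by rewrite !(frob_innerC _ X) frob_innerDr. Qed.

Lemma frob_innerZl (a : R) X Y : frob_inner (a *: X) Y = a * frob_inner X Y.
Proof. by rewrite frob_innerC frob_innerZr frob_innerC. Qed.

Lemma frob_innerNl X Y : frob_inner (- X) Y = - frob_inner X Y.
Proof. by rewrite frob_innerC frob_innerNr frob_innerC. Qed.

Lemma frob_inner0r X : frob_inner X 0 = 0.
Proof. by rewrite /frob_inner mulmx0 mxtrace0. Qed.

Lemma frob_inner0l X : frob_inner 0 X = 0.
Proof. by rewrite frob_innerC frob_inner0r. Qed.

Lemma frob_inner_ge0 X : 0 <= frob_inner X X.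
Proof.
by rewrite frob_innerE; do 2![apply: sumr_ge0 => ? _]; rewrite -expr2 sqr_ge0.
Qed.

Lemma frob_inner_eq0 X : (frob_inner X X == 0) = (X == 0).
Proof.
apply/eqP/eqP => [|->]; last exact: frob_inner0r.
rewrite frob_innerE => /eqP; rewrite psumr_eq0 => [/allP X0|j _]; last first.
  by apply: sumr_ge0 => i _; rewrite -expr2 sqr_ge0.
apply/matrixP => i j; rewrite mxE; apply/eqP.
have := X0 j (mem_index_enum _); rewrite /= psumr_eq0 => [/allP|k _].
  by move/(_ i (mem_index_enum _)); rewrite /= mulf_eq0 orbb.
by rewrite -expr2 sqr_ge0.
Qed.

Lemma frob_inner_gt0 X : (0 < frob_inner X X) = (X != 0).
Proof. by rewrite lt_neqAle frob_inner_ge0 andbT eq_sym frob_inner_eq0. Qed.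

Lemma frob_norm_sqr X : frob_norm X ^+ 2 = frob_inner X X.
Proof. by rewrite sqr_sqrtr ?frob_inner_ge0. Qed.

Lemma frob_inner_delta X i j : frob_inner X (delta_mx i j) = X i j.
Proof.
rewrite frob_innerE (bigD1 j) //= (bigD1 i) //= mxE !eqxx mulr1.
rewrite !big1 ?addr0 // => [k /negPf kj|k /negPf ki]; last first.
  by rewrite mxE ki mulr0.
by rewrite big1 // => l _; rewrite mxE kj andbF mulr0.
Qed.

Lemma frob_inner_all0 X : (forall Y, frob_inner X Y = 0) -> X = 0.
Proof. by move=> X0; apply/eqP; rewrite -frob_inner_eq0 X0. Qed.

End Bilinear.

Lemma frob_inner_sum_col m n (X : 'M[R]_(m, n)) :
  frob_inner X X = \sum_(j < n) frob_inner (col j X) (col j X).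
Proof.
rewrite frob_innerE; apply: eq_bigr => j _; rewrite frob_innerE big_ord1.
by apply: eq_bigr => i _; rewrite !mxE.
Qed.

Definition frob_innerB := (frob_innerDl, frob_innerDr, frob_innerNl,
  frob_innerNr, frob_innerZl, frob_innerZr).

Lemma frob_inner_mulr m n k (X : 'M[R]_(m, k)) (M : 'M[R]_(k, n))
    (Y : 'M[R]_(m, n)) :
  frob_inner (X *m M) Y = frob_inner X (Y *m M^T).
Proof. by rewrite /frob_inner trmx_mul -mulmxA mxtrace_mulC mulmxA. Qed.

Lemma frob_inner_mull m n k (X : 'M[R]_(k, n)) (M : 'M[R]_(m, k))
    (Y : 'M[R]_(m, n)) :
  frob_inner (M *m X) Y = frob_inner X (M^T *m Y).
Proof. by rewrite /frob_inner trmx_mul mulmxA. Qed.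

Lemma frob_inner_outer m n (x y : 'cV[R]_m) (w v : 'cV[R]_n) :
  frob_inner (x *m w^T) (y *m v^T) = frob_inner x y * frob_inner w v.
Proof.
rewrite frob_inner_mulr trmxK -mulmxA [v^T *m w]mx11_scalar.
rewrite mul_mx_scalar frob_innerZr mulrC; congr (_ * _).
by rewrite frob_innerC /frob_inner trace_mx11.
Qed.

End FrobeniusInner.

(** * Orthogonal projections onto row spaces *)

Section RowProjection.
Variable R : realType.

(** If v M M^T = 0, then |v M|^2 = v M M^T v^T = 0, so v M = 0, and row freeness gives v = 0. *)
Lemma gram_unitmx k n (M : 'M[R]_(k, n)) :
  row_free M -> M *m M^T \in unitmx.
Proof.
move=> Mfree; rewrite -row_free_unit; apply/inj_row_free => v.
rewrite mulmxA => vMM0; apply: (row_free_inj Mfree); rewrite mul0mx.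
apply/eqP; rewrite -[v *m M]trmxK trmx_eq0 -frob_inner_eq0 /frob_inner trmxK.
by rewrite trmx_mul mulmxA vMM0 mul0mx mxtrace0.
Qed.

(* With M a row basis of X, the orthogonal projection onto the row space of X
   is M^T (M M^T)^-1 M. *)
Lemma row_projection m n (X : 'M[R]_(m, n)) : exists P : 'M[R]_n,
  [/\ P^T = P, P *m P = P, X *m P = X, exists D, P = X^T *m D
    & \tr P = (\rank X)%:R].
Proof.
have [k [M [<- Mfree /submxP[C XC] /submxP[D MD]]]] :
    exists k (M : 'M[R]_(k, n)),
      [/\ k = \rank X, row_free M, (X <= M)%MS & (M <= X)%MS].
  by exists (\rank X), (row_base X); rewrite row_base_free !eq_row_base.
set K := invmx (M *m M^T).
have Munit := gram_unitmx Mfree.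
have KT : K^T = K by rewrite /K trmx_inv trmx_mul trmxK.
have MP : M *m (M^T *m K *m M) = M by rewrite !mulmxA mulmxV // mul1mx.
exists (M^T *m K *m M); split.
- by rewrite !trmx_mul trmxK KT mulmxA.
- by rewrite -[LHS]mulmxA MP.
- by rewrite XC -(mulmxA C) MP.
- by exists (D^T *m K *m M); rewrite {1}MD trmx_mul !mulmxA.
- by rewrite mxtrace_mulC mulmxA mulmxV // mxtrace1.
Qed.

(** Cyclicity of the trace. This makes the overlap tr (P Q) of two subspaces nonnegative and turns
    the norms of products of projections into rank counts. *)
Lemma frob_inner_projection n (P Q : 'M[R]_n) :
  P^T = P -> P *m P = P -> Q^T = Q -> Q *m Q = Q ->
  frob_inner (P *m Q) (P *m Q) = \tr (P *m Q).
Proof.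
move=> PT PP QT QQ; rewrite frob_inner_mulr QT -mulmxA QQ.
by rewrite /frob_inner PT mulmxA PP.
Qed.

Lemma mulmx_compl_idem n (P : 'M[R]_n) :
  P *m P = P -> (1%:M - P) *m (1%:M - P) = 1%:M - P.
Proof. by move=> PP; rewrite mulmxBr mulmx1 mulmxBl mul1mx PP subrr subr0. Qed.

End RowProjection.

(** * From the growth inequality to restricted optimality *)

Lemma col_mulmx (R : realType) m n k (X : 'M[R]_(m, n)) (M : 'M[R]_(n, k)) j :
  col j (X *m M) = X *m col j M.
Proof. by rewrite !colE mulmxA. Qed.

Section RestrictedOptimality.
Variables (R : realType) (m n : nat).
Implicit Types X G Y : 'M[R]_(m, n).

(** Squared Frobenius norms are sums over columns, so both sides are double sums over pairs of
    columns, compared term by term. *)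
Lemma le_frob_inner_cols k l X G (M : 'M[R]_(n, k)) (N : 'M[R]_(n, l)) (b : R) :
  (forall (i : 'I_k) (w : 'cV[R]_n),
     frob_inner (col i M) (col i M) * frob_inner (G *m w) (G *m w)
     <= b * frob_inner (X *m col i M) (X *m col i M) * frob_inner w w) ->
  frob_inner M M * frob_inner (G *m N) (G *m N)
  <= b * frob_inner (X *m M) (X *m M) * frob_inner N N.
Proof.
move=> le_col.
rewrite !(frob_inner_sum_col M) !(frob_inner_sum_col (_ *m _)).
rewrite (frob_inner_sum_col N) [b * _]mulr_sumr !big_distrlr /=.
by apply: ler_sum => i _; apply: ler_sum => j _; rewrite !col_mulmx.
Qed.

(* Completing the square with T = a X - G turns the claim into
   |T Q|^2 <= |a X|^2, Q being the projection onto the row space of Y; the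
   columns of P (1 - Q) and (1 - P) Q then carry the comparison of the small
   singular values of X with the large ones of G. *)
Lemma restricted_growth X G (a b : R) (r' : nat) Y :
  0 < a -> a <= b -> r'%:R * b ^+ 2 < (\rank X)%:R * a ^+ 2 ->
  X^T *m G = 0 -> G *m X^T = 0 ->
  (forall (y : 'cV[R]_m) (w : 'cV[R]_n), let p := X^T *m y in
     frob_inner p p * frob_inner (G *m w) (G *m w)
     <= b ^+ 2 * frob_inner (X *m p) (X *m p) * frob_inner w w) ->
  (\rank Y <= r')%N ->
  0 <= frob_inner G (Y - X) + a / 2 * frob_inner (X - Y) (X - Y).
Proof.
move=> a_gt0 le_ab lt_r XG0 GX0 growth rkY.
have [P [PT PP XP [D PD] trP]] := row_projection X.
have [Q [QT QQ YQ _ trQ]] := row_projection Y.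
have GP : G *m P = 0 by rewrite PD mulmxA GX0 mul0mx.
have := @le_frob_inner_cols _ _ X G (P *m (1%:M - Q)) ((1%:M - P) *m Q)
  (b ^+ 2).
have -> : G *m ((1%:M - P) *m Q) = G *m Q.
  by rewrite mulmxA mulmxBr mulmx1 GP subr0.
have -> : X *m (P *m (1%:M - Q)) = X *m (1%:M - Q) by rewrite mulmxA XP.
(* [c] measures the overlap of the row spaces of X and Y; the squared norms of P (1 - Q) and (1 - P)
   Q become rank X - c and rank Y - c. *)
set c := \tr (P *m Q).
have c_ge0 : 0 <= c by rewrite /c -frob_inner_projection ?frob_inner_ge0.
have QN : (1%:M - Q)^T = 1%:M - Q by rewrite linearB /= trmx1 QT.
have PN : (1%:M - P)^T = 1%:M - P by rewrite linearB /= trmx1 PT.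
rewrite !frob_inner_projection ?mulmx_compl_idem //.
have -> : \tr (P *m (1%:M - Q)) = (\rank X)%:R - c.
  by rewrite mulmxBr mulmx1 linearB /= trP.
have nPQ : \tr ((1%:M - P) *m Q) = (\rank Y)%:R - c.
  by rewrite mulmxBl mul1mx linearB /= trQ.
have le_cq : 0 <= (\rank Y)%:R - c :> R 
  by rewrite -nPQ -frob_inner_projection ?mulmx_compl_idem ?frob_inner_ge0.
rewrite nPQ.
have le_q : (\rank Y)%:R <= r'%:R :> R by rewrite ler_nat.
set s := frob_inner (X *m (1%:M - Q)) (X *m (1%:M - Q)).
set g := frob_inner (G *m Q) (G *m Q).
have s_ge0 : 0 <= s by exact: frob_inner_ge0.
move=> cols.
have {}cols : ((\rank X)%:R - c) * g <= b ^+ 2 * s * ((\rank Y)%:R - c).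
  apply: cols => i w; rewrite PD; have := growth (D *m col i (1%:M - Q)) w.
  by rewrite /= !col_mulmx !mulmxA.
(* From a <= b, 0 <= c and r' b^2 < a^2 rank X follows b^2 (rank Y - c) <= a^2 (rank X - c); then
   [cols] can be divided by rank X - c. *)
have le_gs : g <= a ^+ 2 * s.
  have a2 : 0 < a ^+ 2 by rewrite exprn_gt0.
  have ab2 : a ^+ 2 <= b ^+ 2 by rewrite lerXn2r // nnegrE; lra.
  (* Since c <= rank Y <= r' and a <= b, a^2 (rank X - c) > r' b^2 - c a^2 >= 0. *)
  have rc : 0 < (\rank X)%:R - c.
    rewrite -(pmulr_lgt0 _ a2).
    have h1 : 0 <= r'%:R * (b ^+ 2 - a ^+ 2).
      by rewrite mulr_ge0 ?ler0n // subr_ge0.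
    have h2 : 0 <= (r'%:R - c) * a ^+ 2 by rewrite mulr_ge0 ?(ltW a2) //; lra.
    lra.
  rewrite -(ler_pM2l rc); apply: (le_trans cols).
  rewrite [leLHS](_ : _ = (b ^+ 2 * ((\rank Y)%:R - c)) * s); last by ring.
  rewrite [leRHS](_ : _ = (a ^+ 2 * ((\rank X)%:R - c)) * s); last by ring.
  rewrite ler_wpM2r //.
  have h1 : 0 <= c * (b ^+ 2 - a ^+ 2) by rewrite mulr_ge0 // subr_ge0.
  have h2 : 0 <= (r'%:R - (\rank Y)%:R) * b ^+ 2.
    by rewrite mulr_ge0 ?sqr_ge0 // subr_ge0.
  lra.
have GX : frob_inner G X = 0.
  by rewrite frob_innerC /frob_inner XG0 mxtrace0.
have GXQ : frob_inner (G *m Q) (X *m Q) = 0.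
  rewrite frob_innerC frob_inner_mull mulmxA XG0 mul0mx.
  exact: frob_inner0r.
have XQX : frob_inner (X *m Q) X = frob_inner (X *m Q) (X *m Q).
  by rewrite !frob_inner_mulr QT -mulmxA QQ.
have sE : s = frob_inner X X - frob_inner (X *m Q) (X *m Q).
  by rewrite /s mulmxBr mulmx1 !frob_innerB (frob_innerC X (_ *m Q)) XQX; ring.
(* With T = a X - G, the goal multiplied by 2 a is |a Y - T Q|^2 + (a^2 s - g). *)
have sq := frob_inner_ge0 (a *: Y - (a *: X - G) *m Q).
have TQ : frob_inner (a *: X - G) Y = frob_inner ((a *: X - G) *m Q) Y.
  by rewrite frob_inner_mulr QT YQ.
move: sq TQ; rewrite !mulmxBl -!scalemxAl !frob_innerB.
rewrite !(frob_innerC Y) !(frob_innerC (X *m Q) (G *m Q)) GXQ -/g.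
rewrite GX => sq TQ; rewrite -(pmulr_rge0 _ (mulr_gt0 (@ltr0Sn R 1) a_gt0)).
have -> : frob_inner G Y = a * frob_inner X Y
    - (a * frob_inner (X *m Q) Y - frob_inner (G *m Q) Y).
  by rewrite -TQ; ring.
move: sq le_gs; rewrite sE; lra.
Qed.

End RestrictedOptimality.

(** * Stationarity at fixed points of PGD *)

Lemma linear_term_eq0 (R : realFieldType) (b c : R) :
  (forall t, 0 <= t * b + t ^+ 2 * c) -> b = 0.
Proof.
move=> ge0; apply/eqP; apply: contraT => b_neq0.
have k_gt0 : 0 < `|c| + 1 by rewrite ltr_wpDl.
(* This t has the sign opposite to b and is small enough for the linear term to outweigh the
   quadratic one. *)
have := ge0 (- b / (`|c| + 1)).
have -> : - b / (`|c| + 1) * b + (- b / (`|c| + 1)) ^+ 2 * c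
    = - (b / (`|c| + 1)) ^+ 2 * (`|c| - c + 1).
  by field; rewrite gt_eqF.
rewrite nmulr_rge0; first by have := ler_norm c; lra.
by rewrite oppr_lt0 exprn_even_gt0 //= mulf_neq0 // invr_eq0 gt_eqF.
Qed.

(** The nonzero row p^T lies in the row space of X and is annihilated by the right factor, so
    rank-nullity forces a drop. *)
Lemma mxrank_compl_lt (R : realType) m n (X : 'M[R]_(m, n)) (y : 'cV[R]_m) :
  let p := X^T *m y in p != 0 ->
  (\rank (X *m (1%:M - (frob_inner p p)^-1 *: (p *m p^T)))%R < \rank X)%N.
Proof.
move=> p p_neq0; set N := 1%:M - _.
have pN : p^T *m N = 0.
  rewrite mulmxBr mulmx1 -scalemxAr mulmxA [p^T *m p]mx11_scalar mul_scalar_mx.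
  rewrite -trace_mx11 scalerA mulVf ?scale1r ?subrr //.
  by rewrite -/(frob_inner p p) frob_inner_eq0.
rewrite -[ltnRHS](mxrank_mul_ker X N) -[ltnLHS]addn0 ltn_add2l lt0n mxrank_eq0.
apply: contraNneq p_neq0 => cap0; rewrite -trmx_eq0 -submx0 -cap0 sub_capmx.
by rewrite sub_kermx pN eqxx andbT /p trmx_mul trmxK submxMl.
Qed.

Section FixedPoint.
Variables (R : realType) (m n r : nat) (f : 'M[R]_(m, n) -> R) (eta : R).
Variable X : 'M[R]_(m, n).
Hypothesis eta_gt0 : 0 < eta.
Hypothesis Xfix : pgd_fixed_point r f eta X.
Let G := gradient f X.

(** Expand |X + D - (X - eta G)|^2 >= |eta G|^2 and cancel. *)
Lemma pgd_fixed_point_ge0 (D : 'M[R]_(m, n)) : (\rank (X + D)%R <= r)%N ->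
  0 <= frob_inner D D + 2 * eta * frob_inner D G.
Proof.
move=> rkD; have /(_ rkD) := proj2 Xfix (X + D).
rewrite !frob_norm_sqr -/G subKr -addrA [D + _]addrC addrA.
rewrite subKr !frob_innerB (frob_innerC G D); lra.
Qed.

Lemma pgd_fixed_point_orth (D : 'M[R]_(m, n)) :
  (forall t, (\rank (X + t *: D)%R <= r)%N) -> frob_inner D G = 0.
Proof.
move=> rkD.
suff: 2 * eta * frob_inner D G = 0.
  by move/eqP; rewrite mulf_eq0 gt_eqF ?mulr_gt0 //= => /eqP.
apply: (@linear_term_eq0 _ _ (frob_inner D D)) => t.
have := pgd_fixed_point_ge0 (rkD t); rewrite !frob_innerB; lra.
Qed.

(** X + t X M = X (1 + t M) has rank at most rank X for every t, so G is orthogonal to every X M. *)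
Lemma pgd_fixed_point_trmul : X^T *m G = 0.
Proof.
apply: frob_inner_all0 => M; rewrite frob_innerC -frob_inner_mull.
apply: pgd_fixed_point_orth => t.
rewrite -[X in X + _]mulmx1 scalemxAr -mulmxDr.
exact: leq_trans (mxrankM_maxl _ _) (proj1 Xfix).
Qed.

Lemma pgd_fixed_point_multr : G *m X^T = 0.
Proof.
apply: frob_inner_all0 => M; rewrite frob_innerC -frob_inner_mulr.
apply: pgd_fixed_point_orth => t.
rewrite -[X in X + _]mul1mx scalemxAl -mulmxDl.
exact: leq_trans (mxrankM_maxr _ _) (proj1 Xfix).
Qed.

(** Below rank r any rank-one perturbation stays feasible, so G is orthogonal to each coordinate
    matrix. *)
Lemma pgd_fixed_point_lowrank : (\rank X < r)%N -> G = 0.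
Proof.
move=> rkX; apply/matrixP => i j; rewrite [RHS]mxE.
rewrite -frob_inner_delta frob_innerC.
apply: pgd_fixed_point_orth => t.
apply: leq_trans (mxrank_add _ _) _; apply: leq_trans rkX.
rewrite -addn1 leq_add2l (leq_trans (mxrank_scale _ _)) //.
by rewrite mxrank_delta.
Qed.

(* Competitor: drop the direction p of X and add a multiple of G w w^T. *)
Lemma pgd_fixed_point_growth (y : 'cV[R]_m) (w : 'cV[R]_n) :
  let p := X^T *m y in
  frob_inner p p * frob_inner (G *m w) (G *m w)
  <= (eta^-1) ^+ 2 * frob_inner (X *m p) (X *m p) * frob_inner w w.
Proof.
rewrite /=; set p := X^T *m y; have [->|p_neq0] := eqVneq p 0.
  by rewrite !mulmx0 !frob_inner0r !mul0r mulr0 mul0r.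
have [->|w_neq0] := eqVneq w 0.
  by rewrite !mulmx0 !frob_inner0r !mulr0.
set d := frob_inner p p; set e := frob_inner w w.
have d_gt0 : 0 < d by rewrite frob_inner_gt0.
have e_gt0 : 0 < e by rewrite frob_inner_gt0.
(* The coefficient s = - eta / e minimizes |s G w w^T|^2 + 2 eta <s G w w^T, G>. *)
pose D := - d^-1 *: (X *m p *m p^T) - (eta / e) *: (G *m w *m w^T).
have rkD : (\rank (X + D)%R <= r)%N.
  rewrite addrA; apply: leq_trans (mxrank_add _ _) _.
  have -> : X + - d^-1 *: (X *m p *m p^T) = X *m (1%:M - d^-1 *: (p *m p^T)).
    by rewrite mulmxBr mulmx1 -scalemxAr (mulmxA X p) scaleNr.
  apply: leq_trans (proj1 Xfix); apply: leq_trans (mxrank_compl_lt p_neq0).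
  rewrite -[leqRHS]addn1 leq_add2l -scaleNr (leq_trans (mxrank_scale _ _)) //.
  exact: leq_trans (mxrankM_maxr _ _) (rank_leq_row _).
have := pgd_fixed_point_ge0 rkD; rewrite !frob_innerB !frob_inner_outer -/d -/e.
have GX0 : frob_inner (G *m w) (X *m p) = 0.
  rewrite frob_innerC frob_inner_mull mulmxA pgd_fixed_point_trmul mul0mx.
  exact: frob_inner0r.
have XG0 : frob_inner (X *m p *m p^T) G = 0.
  by rewrite -mulmxA frob_inner_mull pgd_fixed_point_trmul frob_inner0r.
have GG : frob_inner (G *m w *m w^T) G = frob_inner (G *m w) (G *m w).
  by rewrite frob_inner_mulr trmxK.
rewrite (frob_innerC (X *m p)) GX0 XG0 GG.
set x := frob_inner (X *m p) _; set g := frob_inner (G *m w) _ => ge0.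
rewrite -subr_ge0.
set L := (X in 0 <= X) in ge0.
have -> : eta^-1 ^+ 2 * x * e - d * g = d * e / eta ^+ 2 * L.
  by rewrite /L; field; rewrite !gt_eqF.
by rewrite mulr_ge0 // ltW // divr_gt0 ?mulr_gt0 ?exprn_gt0.
Qed.

End FixedPoint.

(** * Derivatives along lines and a one-variable second-order test *)

Lemma derive_line (R : realType) (V : normedModType R) (g : V -> R)
    (z w : V) (s : R) :
  'D_w g (z + s *: w) = 'D_1 (fun t : R => g (z + t *: w)) s.
Proof.
rewrite /derive; set g1 := fun h => h^-1 *: _; set g2 := fun h => h^-1 *: _.
suff -> : g1 = g2 by [].
by apply/funext => h; rewrite /g1 /g2 /= [h *: 1]mulr1 scalerDl addrCA.
Qed.

(* Near 0, dphi t >= - e t for every e > 0; the mean value theorem turns this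
   into a lower bound on phi without a Taylor expansion. *)
Lemma second_order_coef_ge0 (R : realType) (phi dphi : R -> R) (a b c : R) :
  (forall t : R, is_derive t 1 phi (dphi t)) -> dphi 0 = 0 ->
  derivable dphi 0 1 -> 0 <= 'D_1 dphi 0 ->
  (\forall t \near (0 : R)^'+,
     phi t <= phi 0 + t ^+ 2 * (a + t * b + t ^+ 2 * c)) ->
  0 <= a.
Proof.
move=> Dphi dphi0 ddphi ge0 le_phi; rewrite leNgt; apply/negP => a_lt0.
(* With a = - 4 e and remainder below e, the upper bound gives phi t - phi 0 < - 3 e t^2, while the
   mean value theorem will give phi t - phi 0 > - e t^2. *)
pose e : R := - a / 4.
have e_gt0 : 0 < e by rewrite /e; lra.
have near_dphi : \forall t \near (0 : R)^'+, - e * t < dphi t.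
  (* As dphi 0 = 0, this is the difference quotient of [dphi] at 0, whose limit is nonnegative. *)
  have : (fun h => h^-1 * dphi h) @ 0^' --> 'D_1 dphi 0.
    have := ddphi; rewrite /derivable /derive.
    by under eq_fun do rewrite /= addr0 [_ *: 1]mulr1 dphi0 subr0.
  move/cvgrPdist_lt/(_ _ e_gt0) => h.
  have {h} h : \forall t \near (0 : R)^'+, `|'D_1 dphi 0 - t^-1 * dphi t| < e.
    by case: h => d d_gt0 h; exists d => // t /h + t_gt0; apply; rewrite gt_eqF.
  near=> t.
  have t_gt0 : 0 < t by near: t; exact: nbhs_right_gt.
  have : `|'D_1 dphi 0 - t^-1 * dphi t| < e by near: t.
  rewrite ltr_norml => /andP[_]; rewrite ltrBlDr => lt.
  have {}lt : - e < t^-1 * dphi t by lra.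
  by rewrite -ltr_pdivlMr // mulrC.
have near_rem : \forall t \near (0 : R)^'+, t * b + t ^+ 2 * c < e.
  near=> t.
  have t_gt0 : 0 < t by near: t; exact: nbhs_right_gt.
  have t_lt1 : t < 1 by near: t; exact: nbhs_right_lt.
  have k_gt0 : 0 < `|b| + `|c| + 1 by rewrite ltr_wpDl // addr_ge0.
  have : t < e / (`|b| + `|c| + 1).
    by near: t; apply: nbhs_right_lt; rewrite divr_gt0.
  rewrite ltr_pdivlMr // => lt_e; apply: le_lt_trans lt_e.
  have : t * b <= t * `|b| by rewrite ler_pM2l // ler_norm.
  have : t ^+ 2 * c <= t ^+ 2 * `|c| by rewrite ler_pM2l ?exprn_gt0 // ler_norm.
  have : t ^+ 2 * `|c| <= t * `|c| by rewrite ler_wpM2r // expr2 ger_pMl // ltW.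
  lra.
have [d /= d_gt0 nearP] : \forall t \near (0 : R)^'+,
    [/\ phi t <= phi 0 + t ^+ 2 * (a + t * b + t ^+ 2 * c),
        - e * t < dphi t & t * b + t ^+ 2 * c < e].
  by near=> t; split; near: t.
have {}nearP t : 0 < t -> t < d ->
    [/\ phi t <= phi 0 + t ^+ 2 * (a + t * b + t ^+ 2 * c),
        - e * t < dphi t & t * b + t ^+ 2 * c < e].
  move=> t_gt0 t_lt; apply: nearP => //=.
  by rewrite sub0r normrN gtr0_norm.
pose t := d / 2.
have t_gt0 : 0 < t by rewrite /t; lra.
have t_ltd : t < d by rewrite /t; lra.
have cphi : {within `[0, t], continuous phi}.
  by apply: derivable_within_continuous => x _; exact: ex_derive.
have [s] := MVT t_gt0 (fun x _ => Dphi x) cphi.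
rewrite in_itv /= => /andP[s_gt0 s_lt]; rewrite subr0 => phit.
have [le_phit _ rem] := nearP t t_gt0 t_ltd.
have [_ lt_dphi _] := nearP s s_gt0 (lt_trans s_lt t_ltd).
have t2 : 0 < t ^+ 2 by rewrite exprn_gt0.
have : t ^+ 2 * (a + t * b + t ^+ 2 * c) < t ^+ 2 * (a + e).
  by rewrite ltr_pM2l //; lra.
(* Since 0 < s < t, the bound - e s < dphi s weakens to - e t < dphi s. *)
have : - e * t * t < dphi s * t.
  rewrite ltr_pM2r //; apply: lt_trans lt_dphi.
  by rewrite !mulNr ltrN2 ltr_pM2l.
have : 0 < t ^+ 2 * e by rewrite mulr_gt0.
rewrite /e in le_phit phit *; lra.
Unshelve. all: by end_near.
Qed.

(** * Gradients and derivatives of matrix curves *)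

Section Gradient.
Variables (R : realType) (m n : nat).
Implicit Types (f : 'M[R]_(m, n) -> R) (F : R -> 'M[R]_(m, n)).

Lemma diff_gradient f X V :
  differentiable f X -> 'd f X V = frob_inner (gradient f X) V.
Proof.
move=> df; rewrite {1}(matrix_sum_delta V) linear_sum frob_innerE exchange_big.
apply: eq_bigr => i _; rewrite linear_sum; apply: eq_bigr => j _.
by rewrite linearZ /= -deriveE // mxE mulrC.
Qed.

Lemma is_derive_comp_gradient f F (dF : 'M[R]_(m, n)) t :
  differentiable f (F t) -> is_derive t 1 F dF ->
  is_derive t 1 (f \o F) (frob_inner (gradient f (F t)) dF).
Proof.
move=> df [/derivable1_diffP dF_ dFE].
have dfF : differentiable (f \o F) t by exact: differentiable_comp.
apply: DeriveDef; first exact/derivable1_diffP.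
by rewrite deriveE // diff_comp //= diff_gradient // -deriveE // dFE.
Qed.

Lemma is_derive_quadratic (X D E : 'M[R]_(m, n)) (t : R) :
  is_derive t 1 (fun t : R => X + t *: D + t ^+ 2 *: E) (D + (2 * t) *: E).
Proof.
have dij i j : is_derive t 1 (fun t : R => (X + t *: D + t ^+ 2 *: E) i j)
    ((D + (2 * t) *: E) i j).
  have -> : (fun t => (X + t *: D + t ^+ 2 *: E) i j)
      = cst (X i j) + (id * cst (D i j)) + (id ^+ 2 * cst (E i j)) :> (R -> R).
    by apply/funext => u; rewrite !mxE.
  apply: is_derive_eq; rewrite !mxE.
  by rewrite /GRing.scale /=; ring.
apply: DeriveDef; first by apply/derivable_mxP => i j; exact: ex_derive.
rewrite derive_mx; last by apply/derivable_mxP => i j; exact: ex_derive.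
by apply/matrixP => i j; rewrite mxE derive_val.
Qed.

Lemma derivable_frob_inner F (K : R -> 'M[R]_(m, n)) t :
  derivable F (t : R) 1 -> derivable K t 1 ->
  derivable (fun u => frob_inner (F u) (K u)) t 1.
Proof.
move=> /derivable_mxP dF /derivable_mxP dK.
have -> : (fun u => frob_inner (F u) (K u)) = \sum_(j < n) \sum_(i < m)
    ((fun u => F u i j) * (fun u => K u i j)).
  apply/funext => u; rewrite frob_innerE fct_sumE; apply: eq_bigr => j _.
  by rewrite fct_sumE.
apply: derivable_sum => j; apply: derivable_sum => i; exact: derivableM.
Qed.

End Gradient.

(** * First- and second-order conditions for the factorized problem *)

Section Factorized.
Variables (R : realType) (m n r : nat) (f : 'M[R]_(m, n) -> R).
Hypothesis f_diff2 : twice_differentiable f.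
Variables (A : 'M[R]_(m, r)) (B : 'M[R]_(n, r)).
Let X := A *m B^T.
Let G := gradient f X.
(** The product (A + t U)(B + t W)^T multiplied out, so that its velocity and acceleration can be
    read off. *)
Definition factor_curve (U : 'M[R]_(m, r)) (W : 'M[R]_(n, r)) (t : R) :=
  X + t *: (A *m W^T + U *m B^T) + t ^+ 2 *: (U *m W^T).

Lemma factor_curveE U W t :
  factor_curve U W t = (A + t *: U) *m (B + t *: W)^T.
Proof.
rewrite linearD /= linearZ /= mulmxDl !mulmxDr -!scalemxAr -!scalemxAl.
by rewrite scalerA -expr2 /factor_curve scalerDr -/X !addrA.
Qed.

Lemma factorized_curve U W t :
  factorized f (A + t *: U, B + t *: W) = f (factor_curve U W t).
Proof. by rewrite factor_curveE. Qed.

Lemma is_derive_curve U W (t : R) : is_derive t 1 (f \o factor_curve U W)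
  (frob_inner (gradient f (factor_curve U W t))
     (A *m W^T + U *m B^T + (2 * t) *: (U *m W^T))).
Proof.
apply: is_derive_comp_gradient; first by case: (f_diff2 (factor_curve U W t)).
exact: is_derive_quadratic.
Qed.

Lemma curve0 U W : factor_curve U W 0 = X.
Proof. by rewrite /factor_curve expr0n !scale0r !addr0. Qed.

Lemma derive_curve0 U W :
  'D_1 (f \o factor_curve U W) 0 = frob_inner G (A *m W^T + U *m B^T).
Proof.
have /@derive_val -> := is_derive_curve U W 0.
by rewrite curve0 mulr0 scale0r addr0.
Qed.

(** Moving one entry of A or B gives the derivatives <G, E_ij B^T> = (G B)_ij and <G, A E_ij> = (A^T
    G)_ij. *)
Lemma gradient_pair_eq0 : gradient_pair (@factorized R m n r f) (A, B) = 0 ->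
  G *m B = 0 /\ A^T *m G = 0.
Proof.
case=> /matrixP gradA /matrixP gradB; split; apply/matrixP => i j.
  have := gradA i j; rewrite !mxE.
  (* The base point is rewritten as z + 0 w to match [derive_line]. *)
  rewrite -[X in 'D_ _ _ X]addr0 -(scale0r (delta_mx i j)) derive_line.
  have -> : (fun t : R => factorized f (A + t *: delta_mx i j, B))
      = f \o factor_curve (delta_mx i j) 0.
    by apply/funext => t /=; rewrite -factorized_curve scaler0 addr0.
  rewrite derive_curve0 trmx0 mulmx0 add0r frob_innerC frob_inner_mulr trmxK.
  by rewrite frob_innerC frob_inner_delta !mxE.
have := gradB j i; rewrite !mxE.
rewrite -[X in 'D_ _ _ X]addr0 -(scale0r (delta_mx j i)) derive_line.
have -> : (fun t : R => factorized f (A, B + t *: delta_mx j i))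
    = f \o factor_curve 0 (delta_mx j i).
  by apply/funext => t /=; rewrite -factorized_curve scaler0 addr0.
rewrite derive_curve0 mul0mx addr0 frob_innerC frob_inner_mull trmx_delta.
by rewrite frob_innerC frob_inner_delta !mxE.
Qed.

Lemma hessian_curve U W :
  hessian (@factorized R m n r f) (A, B) (U, W) (U, W)
  = 'D_1 (fun t : R => 'D_1 (f \o factor_curve U W) t) 0.
Proof.
have gE : (fun t : R => factorized f ((A, B) + t *: (U, W)))
    = f \o factor_curve U W.
  by apply/funext => t; rewrite /= -factorized_curve.
have DgE : (fun t : R =>
      'D_(U, W) (@factorized R m n r f) ((A, B) + t *: (U, W)))
    = (fun t : R => 'D_1 (f \o factor_curve U W) t).
  by apply/funext => t; rewrite derive_line gE.
by rewrite /hessian -{1}[(A, B)]addr0 -{1}(scale0r (U, W)) derive_line DgE.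
Qed.

Lemma rank_curve U W t : (\rank (factor_curve U W t) <= r)%N.
Proof.
rewrite factor_curveE; exact: leq_trans (mxrankM_maxl _ _) (rank_leq_col _).
Qed.

(** Smoothness bounds f along the curve by a polynomial with no linear term and t^2 coefficient <G,
    E> + beta/2 |D|^2; a nonnegative second derivative at 0 forbids a negative coefficient. *)
Lemma SOSP_curvature (calX : set 'M[R]_(m, n)) (beta : R) U W :
  relatively_open (@rank_le R m n r) calX -> RSM beta f calX -> calX X ->
  SOSP (@factorized R m n r f) (A, B) ->
  0 <= 2 * frob_inner G (U *m W^T)
       + beta * frob_inner (A *m W^T + U *m B^T) (A *m W^T + U *m B^T).
Proof.
move=> [V V_open calXE] smooth calXX [/gradient_pair_eq0[GB AG] hess].
set D := A *m W^T + U *m B^T; set E := U *m W^T.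
have GD : frob_inner G D = 0.
  rewrite /D frob_innerDr frob_innerC frob_inner_mull AG frob_inner0r.
  by rewrite frob_innerC frob_inner_mulr trmxK GB frob_inner0r addr0.
suff : 0 <= frob_inner G E + beta / 2 * frob_inner D D by lra.
pose dphi t := frob_inner (gradient f (factor_curve U W t)) (D + (2 * t) *: E).
have Dcurve (t : R) : is_derive t 1 (factor_curve U W) (D + (2 * t) *: E).
  exact: is_derive_quadratic.
(* The two higher coefficients come from expanding beta/2 |D + t E|^2. *)
apply: (@second_order_coef_ge0 _ (f \o factor_curve U W) dphi _
  (beta * frob_inner D E) (beta / 2 * frob_inner E E)).
- exact: is_derive_curve.
- by rewrite /dphi curve0 mulr0 scale0r addr0.
- apply: derivable_frob_inner.
    apply/derivable1_diffP; apply: differentiable_comp.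
      by apply/derivable1_diffP; exact: ex_derive.
    by case: (f_diff2 (factor_curve U W 0)).
  have [dE _] := is_derive_quadratic D (2 *: E) 0 0.
  suff -> : (fun t : R => D + (2 * t) *: E)
      = (fun t : R => D + t *: (2 *: E) + t ^+ 2 *: 0) by [].
  by apply/funext => t; rewrite scaler0 addr0 scalerA mulrC.
- have := hess (U, W); rewrite hessian_curve.
  suff -> : (fun t : R => 'D_1 (f \o factor_curve U W) t) = dphi by [].
  by apply/funext => t; have /@derive_val -> := is_derive_curve U W t.
(* The curve stays in the open set V for small t and has rank at most r by its factorization, hence
   stays in [calX]. *)
have nearO : \forall t \near (0 : R), V (factor_curve U W t).
  have : {for 0, continuous (factor_curve U W)}.
    apply: differentiable_continuous; apply/derivable1_diffP; exact: ex_derive.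
  apply; rewrite curve0; apply: open_nbhs_nbhs; split => //.
  by move: calXX; rewrite calXE => -[].
near=> t; rewrite /= curve0.
have calXt : calX (factor_curve U W t).
  rewrite calXE; split; last exact: rank_curve.
  by near: t; exact: cvg_within nearO.
have curveE : factor_curve U W t - X = t *: D + t ^+ 2 *: E.
  by apply/eqP; rewrite subr_eq addrC addrA.
apply: le_trans (smooth _ _ calXX calXt) _.
rewrite frob_norm_sqr -(opprB (factor_curve U W t)) curveE.
have GtD : frob_inner G (t *: D + t ^+ 2 *: E) = t ^+ 2 * frob_inner G E.
  by rewrite frob_innerDr !frob_innerZr GD; ring.
have sqr_tD (V1 V2 : 'M[R]_(m, n)) :
    frob_inner (- (t *: V1 + t ^+ 2 *: V2)) (- (t *: V1 + t ^+ 2 *: V2))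
    = t ^+ 2 * (frob_inner V1 V1 + 2 * t * frob_inner V1 V2
                + t ^+ 2 * frob_inner V2 V2).
  by rewrite !frob_innerB (frob_innerC V2 V1); ring.
rewrite -/X -/G GtD sqr_tD; lra.
Unshelve. all: by end_near.
Qed.

End Factorized.

(** * Consequences of the curvature inequality *)

Lemma exists_kernel_col (F : fieldType) m r (A : 'M[F]_(m, r)) :
  (\rank A < r)%N -> exists2 u : 'cV[F]_r, u != 0 & A *m u = 0.
Proof.
move=> rkA; have : kermx A^T != 0.
  by rewrite kermx_eq0 /row_free mxrank_tr ltn_eqF.
move/negPf; rewrite -nz_row_eq0 => /negbT nz; exists (nz_row (kermx A^T))^T.
  by rewrite trmx_eq0.
have /sub_kermxP /(congr1 trmx) := nz_row_sub (kermx A^T).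
by rewrite trmx_mul trmxK trmx0.
Qed.

Section Curvature.
Variables (R : realType) (m n r : nat) (A : 'M[R]_(m, r)) (B : 'M[R]_(n, r)).
Variables (G : 'M[R]_(m, n)) (beta : R).
Hypothesis curvature : forall (U : 'M[R]_(m, r)) (W : 'M[R]_(n, r)),
  0 <= 2 * frob_inner G (U *m W^T)
       + beta * frob_inner (A *m W^T + U *m B^T) (A *m W^T + U *m B^T).

(** If A and B both had rank r, so would A B^T; hence some u != 0 is killed by A or B. Along x u^T
    and w u^T, with t scaling one of them, the killed term vanishes, leaving <G, x w^T> as the
    linear coefficient of a nonnegative quadratic in t. *)
Lemma curvature_lowrank : (\rank (A *m B^T) < r)%N -> G = 0.
Proof.
move=> rkX.
suff Gxw (x : 'cV[R]_m) (w : 'cV[R]_n) : frob_inner G (x *m w^T) = 0.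
  apply/matrixP => i j; rewrite [RHS]mxE -frob_inner_delta.
  by rewrite -(mul_delta_mx (0 : 'I_1)) -[delta_mx 0 j]trmx_delta Gxw.
have [u u_neq0 ABu] : exists2 u : 'cV[R]_r, u != 0 & A *m u = 0 \/ B *m u = 0.
  have [rkA|rkA] := ltnP (\rank A) r.
    by have [u u0 Au] := exists_kernel_col rkA; exists u => //; left.
  have [|u u0 Bu] := @exists_kernel_col _ _ _ B; last by exists u => //; right.
  rewrite ltnNge; apply: contraL rkX => rkB; rewrite -leqNgt.
  rewrite mxrankMfree // /row_free mxrank_tr eqn_leq rkB andbT.
  exact: rank_leq_col.
have uu : u^T *m u = (frob_inner u u)%:M.
  by rewrite [LHS]mx11_scalar -trace_mx11.
have u_gt0 : 0 < frob_inner u u by rewrite frob_inner_gt0.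
suff : 2 * frob_inner u u * frob_inner G (x *m w^T) = 0.
  by move/eqP; rewrite mulf_eq0 gt_eqF ?mulr_gt0 //= => /eqP.
have WT : (w *m u^T)^T = u *m w^T by rewrite trmx_mul trmxK.
have UWT : x *m u^T *m (u *m w^T) = frob_inner u u *: (x *m w^T).
  by rewrite mulmxA -(mulmxA x) uu mul_mx_scalar -scalemxAl.
case: ABu => [Au|Bu].
  apply: (@linear_term_eq0 _ _
    (beta * frob_inner (x *m u^T *m B^T) (x *m u^T *m B^T))) => t.
  have := curvature (t *: (x *m u^T)) (w *m u^T).
  rewrite WT (mulmxA A) Au mul0mx add0r -!scalemxAl UWT !frob_innerB; lra.
apply: (@linear_term_eq0 _ _
  (beta * frob_inner (A *m (u *m w^T)) (A *m (u *m w^T)))) => t.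
have := curvature (x *m u^T) (t *: (w *m u^T)).
rewrite -(mulmxA x u^T B^T) -trmx_mul Bu trmx0 mulmx0 addr0.
rewrite linearZ /= WT -!scalemxAr UWT !frob_innerB; lra.
Qed.

(* The test direction is U = - (G w / beta) u^T and W = w v^T, with B u = p and
   v = B^T p. *)
Lemma curvature_growth : A^T *m G = 0 -> 0 < beta ->
  forall (y : 'cV[R]_m) (w : 'cV[R]_n), let p := (A *m B^T)^T *m y in
    frob_inner p p * frob_inner (G *m w) (G *m w)
    <= beta ^+ 2 * frob_inner (A *m B^T *m p) (A *m B^T *m p) * frob_inner w w.
Proof.
move=> AG beta_gt0 y w /=; set p := _ *m y.
have pE : p = B *m (A^T *m y) by rewrite /p trmx_mul trmxK mulmxA.
have := curvature (- beta^-1 *: (G *m w *m (A^T *m y)^T)) (w *m (B^T *m p)^T).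
clearbody p.
have -> : A *m (w *m (B^T *m p)^T)^T = A *m B^T *m p *m w^T.
  by rewrite trmx_mul trmxK !mulmxA.
have -> : - beta^-1 *: (G *m w *m (A^T *m y)^T) *m B^T
    = - beta^-1 *: (G *m w *m p^T).
  by rewrite -scalemxAl pE [in RHS]trmx_mul !mulmxA.
have -> : - beta^-1 *: (G *m w *m (A^T *m y)^T) *m (w *m (B^T *m p)^T)^T
    = - beta^-1 *: (frob_inner p p *: (G *m w *m w^T)).
  rewrite -scalemxAl; congr (_ *: _).
  (* With u = A^T y and B u = p, this is u^T B^T p = |p|^2, so U W^T is a multiple of G w w^T. *)
  have yBp : (A^T *m y)^T *m (B^T *m p) = (frob_inner p p)%:M.
    by rewrite mulmxA -(trmx_mul B) -pE [LHS]mx11_scalar -trace_mx11.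
  rewrite (trmx_mul w) trmxK mulmxA -(mulmxA (G *m w)) yBp.
  by rewrite mul_mx_scalar -scalemxAl.
rewrite !frob_innerB !frob_inner_outer.
have -> : frob_inner G (G *m w *m w^T) = frob_inner (G *m w) (G *m w).
  by rewrite frob_innerC frob_inner_mulr trmxK.
have XGw : frob_inner (A *m B^T *m p) (G *m w) = 0.
  by rewrite -mulmxA frob_inner_mull mulmxA AG mul0mx frob_inner0r.
rewrite (frob_innerC (G *m w)) XGw.
set x := frob_inner (A *m B^T *m p) _; set g := frob_inner (G *m w) _.
set d := frob_inner p p; set e := frob_inner w w => ge0.
rewrite -subr_ge0; set L := (X in 0 <= X) in ge0.
have -> : beta ^+ 2 * x * e - d * g = beta * L.
  by rewrite /L; field; rewrite gt_eqF.
by rewrite mulr_ge0 // ltW.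
Qed.

End Curvature.

(** * Common conclusion for both kinds of stationary point *)

Lemma growth_restricted_optimal (R : realType) m n r (f : 'M[R]_(m, n) -> R)
    (calX : set 'M[R]_(m, n)) (alpha beta : R) (X : 'M[R]_(m, n)) (r' : nat) :
  let G := gradient f X in
  0 < alpha -> RSC alpha f calX -> RSM beta f calX -> calX X ->
  (\rank X <= r)%N -> r'%:R < r%:R / (beta / alpha) ^+ 2 ->
  (0 < beta -> [/\ X^T *m G = 0, G *m X^T = 0, (\rank X < r)%N -> G = 0 &
    forall (y : 'cV[R]_m) (w : 'cV[R]_n), let p := X^T *m y in
     frob_inner p p * frob_inner (G *m w) (G *m w)
     <= beta ^+ 2 * frob_inner (X *m p) (X *m p) * frob_inner w w]) ->
  restricted_optimal f calX r' X.
Proof.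
move=> G alpha_gt0 rsc rsm calXX rkX lt_r stationary Y calXY rkY.
(* For distinct X and Y, RSC and RSM at this pair together give alpha <= beta, hence beta > 0. *)
have [->//|XY] := eqVneq X Y.
have := rsc _ _ calXX calXY; have := rsm _ _ calXX calXY.
rewrite frob_norm_sqr -/G => up lo.
have d_gt0 : 0 < frob_inner (X - Y) (X - Y) by rewrite frob_inner_gt0 subr_eq0.
have le_ab : alpha <= beta.
  by rewrite -(ler_pM2r d_gt0); move: (le_trans lo up); lra.
have beta_gt0 := lt_le_trans alpha_gt0 le_ab.
have [XG GX lowrank growth] := stationary beta_gt0.
suff : 0 <= frob_inner G (Y - X) + alpha / 2 * frob_inner (X - Y) (X - Y).
  by move: lo; lra.
(* At rank r the growth comparison applies; below it G = 0 and only the nonnegative quadratic term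
   remains. *)
move: rkX; rewrite leq_eqVlt => /orP[/eqP rkX|/lowrank ->]; last first.
  by rewrite frob_inner0l add0r mulr_ge0 ?divr_ge0 ?frob_inner_ge0 // ltW.
apply: (restricted_growth alpha_gt0 le_ab _ XG GX growth rkY).
move: lt_r; rewrite rkX exprMn exprVn invfM invrK mulrA mulrAC.
by rewrite ltr_pdivlMr // exprn_gt0.
Qed.

Unset Implicit Arguments.

Theorem theorem4 (R : realType) (m n r : nat)
    (m_gt0 : (0 < m)%N) (n_gt0 : (0 < n)%N) (r_gt0 : (0 < r)%N)
    (f : 'M[R]_(m, n) -> R) (f_diff2 : twice_differentiable f)
    (calX : set 'M[R]_(m, n))
    (calX_open : relatively_open (@rank_le R m n r) calX)
    (alpha beta : R) (alpha_gt0 : 0 < alpha)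
    (f_RSC : RSC alpha f calX) (f_RSM : RSM beta f calX) :
  let kappa := beta / alpha in
  (forall X : 'M[R]_(m, n), calX X -> pgd_fixed_point r f (1 / beta) X ->
     forall r' : nat, r'%:R < r%:R / kappa ^+ 2 ->
       restricted_optimal f calX r' X)
  /\
  (forall (A : 'M[R]_(m, r)) (B : 'M[R]_(n, r)), calX (A *m B^T) ->
     SOSP (@factorized R m n r f) (A, B) ->
     forall r' : nat, r'%:R < r%:R / kappa ^+ 2 ->
       restricted_optimal f calX r' (A *m B^T)).
Proof.
move=> kappa; split=> [X calXX Xfix|A B calXX sosp] r' lt_r.
  apply: (growth_restricted_optimal alpha_gt0 f_RSC f_RSM calXX _ lt_r).
    exact: (proj1 Xfix).
  move=> beta_gt0; have eta_gt0 : 0 < 1 / beta by rewrite divr_gt0.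
  split.
  - exact: pgd_fixed_point_trmul eta_gt0 Xfix.
  - exact: pgd_fixed_point_multr eta_gt0 Xfix.
  - exact: pgd_fixed_point_lowrank eta_gt0 Xfix.
  (* For eta = 1 / beta the factor eta^-1 of the growth bound is beta. *)
  - by have := pgd_fixed_point_growth eta_gt0 Xfix; rewrite div1r invrK.
have curv U W := SOSP_curvature f_diff2 U W calX_open f_RSM calXX sosp.
have [GB AG] := gradient_pair_eq0 f_diff2 (proj1 sosp).
apply: (growth_restricted_optimal alpha_gt0 f_RSC f_RSM calXX _ lt_r).
  exact: leq_trans (mxrankM_maxl _ _) (rank_leq_col _).
move=> beta_gt0; split.
- by rewrite trmx_mul trmxK -mulmxA AG mulmx0.
- by rewrite trmx_mul trmxK mulmxA GB mul0mx.
- exact: curvature_lowrank curv.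
- exact: curvature_growth curv AG beta_gt0.
Qed.
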